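(* If $\Gamma$ is an ellipse which is not a circle, then the matching problem for $\Gamma$ has only the trivial solution (every solution $(f,g)$ consists of constants).
   Context: For a Jordan curve $\Gamma$ with interior domain $\Omega$ and exterior domain $\Omega':=\widehat{\mathbb C}\setminus\overline\Omega$, a solution of the matching problem is a pair $(f,g)$ with: $f$ holomorphic in $\Omega$ and continuous on $\overline\Omega$; $g$ holomorphic in $\Omega'$, continuous on $\overline{\Omega'}$, with $g(\infty)=0$; and $f(\zeta)=\overline{g(\zeta)}$ for all $\zeta\in\Gamma$. It is non-trivial if $f,g$ are non-constant. *)

(* Defs.v *)
From Stdlib Require Import Reals.
From Coquelicot Require Import Coquelicot.
Open Scope R_scope.

Definition C_differentiable (f : C -> C) (z : C) : Prop :=
  ex_derive (K := C_AbsRing) (V := C_NormedModule) f z.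

Definition holomorphic_on (U : C -> Prop) (f : C -> C) : Prop :=
  forall z, U z -> C_differentiable f z.

Definition continuous_on (S : C -> Prop) (f : C -> C) : Prop :=
  forall z, S z -> filterlim f (within S (locally z)) (locally (f z)).

(* The ellipse with center c, semi-axes a, b > 0, rotated by angle th:
   Gamma = { c + e^{i th} (a cos t + i b sin t) }.  ell_q c a b th z < 1, = 1, > 1
   characterize the interior, the curve, and the (finite part of the) exterior. *)
Definition ell_q (c : C) (a b th : R) (z : C) : R :=
  let w := Cmult (Cminus z c) (cos th, - sin th) in
  (Re w / a) ^ 2 + (Im w / b) ^ 2.

Definition ellipse (c : C) (a b th : R) : C -> Prop := fun z => ell_q c a b th z = 1.
Definition ell_interior (c : C) (a b th : R) : C -> Prop := fun z => ell_q c a b th z < 1.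
Definition ell_interior_closure (c : C) (a b th : R) : C -> Prop := fun z => ell_q c a b th z <= 1.
(* finite points of the exterior domain Omega' (Omega' also contains infinity) *)
Definition ell_exterior (c : C) (a b th : R) : C -> Prop := fun z => 1 < ell_q c a b th z.
Definition ell_exterior_closure (c : C) (a b th : R) : C -> Prop := fun z => 1 <= ell_q c a b th z.

(* g read in the chart w = 1/z at infinity, with the value g(infinity) := 0 *)
Definition chart_at_infty (g : C -> C) : C -> C :=
  fun w => if Req_EM_T (Cmod w) 0 then RtoC 0 else g (Cinv w).

Definition matching_solution (c : C) (a b th : R) (f g : C -> C) : Prop :=
  holomorphic_on (ell_interior c a b th) f /\
  continuous_on (ell_interior_closure c a b th) f /\
  holomorphic_on (ell_exterior c a b th) g /\
  (* g holomorphic at infinity with g(infinity) = 0 *)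
  C_differentiable (chart_at_infty g) (RtoC 0) /\
  continuous_on (ell_exterior_closure c a b th) g /\
  (forall z, ellipse c a b th z -> f z = Cconj (g z)).

(* Main.v *)
Require Import Defs.
From Stdlib Require Import Reals.
From Coquelicot Require Import Coquelicot.
From Stdlib Require Import Lra Classical ChoiceFacts IndefiniteDescription FunctionalExtensionality.
Open Scope R_scope.

(** In elliptic coordinates [z = c + e^(i th) k cosh u] the ellipse is the line [Re u = x0], its
    interior is covered by [0 <= Re u < x0], with the two points [i y] and [- i y] of the line
    [Re u = 0] lying over the same point of the focal segment, and its exterior by [Re u > x0].
    The pulled back functions [F] and [G] are [2 pi i]-periodic, so by Goursat's theorem the
    integral of [F u * conj (F (conj u))] over a vertical period is the same on [Re u = 0], where
    it is that of [|F| ^ 2], and on [Re u = x0], where [F = conj G] makes it conjugate to the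
    integral of [G u * conj (G (conj u))]. The latter can be moved to infinity, where [G]
    vanishes. Hence [F = 0] on [Re u = 0]. Finally, a periodic holomorphic function vanishing
    on one edge of a strip vanishes on the strip, so [F = 0], and then [G = 0]. *)

(** * Integrals of continuous real functions *)

Lemma ex_RInt_continuous_R (h : R -> R) (a b : R) :
  (forall t, continuous h t) -> ex_RInt h a b.
Proof. intros h_cont. apply (ex_RInt_continuous (V := R_CompleteNormedModule)); auto. Qed.

Lemma continuous_Rminus (h k : R -> R) (t : R) :
  continuous h t -> continuous k t -> continuous (fun s => h s - k s) t.
Proof. apply (continuous_minus (V := R_NormedModule)). Qed.

Lemma RInt_Chasles_continuous (h : R -> R) (a b c : R) :
  (forall t, continuous h t) -> RInt h a c = RInt h a b + RInt h b c.
Proof.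
  intros h_cont. symmetry. apply (RInt_Chasles (V := R_CompleteNormedModule));
    apply ex_RInt_continuous_R, h_cont.
Qed.

Lemma RInt_minus_continuous (h k : R -> R) (a b : R) :
  (forall t, continuous h t) -> (forall t, continuous k t) ->
  RInt (fun t => h t - k t) a b = RInt h a b - RInt k a b.
Proof.
  intros h_cont k_cont.
  apply (RInt_minus (V := R_CompleteNormedModule)); apply ex_RInt_continuous_R; assumption.
Qed.

Lemma Rabs_RInt_minus_const_le (h : R -> R) (a b c M : R) :
  a <= b -> (forall t, continuous h t) -> (forall t, a <= t <= b -> Rabs (h t - c) <= M) ->
  Rabs (RInt h a b - (b - a) * c) <= (b - a) * M.
Proof.
  intros ab h_cont bound.
  assert (const_cont : forall t : R, continuous (fun _ : R => c) t)
    by (intros t; apply continuous_const).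
  replace (RInt h a b - (b - a) * c) with (RInt (fun t => h t - c) a b).
  - apply abs_RInt_le_const; [exact ab | | exact bound].
    apply ex_RInt_continuous_R. intros t.
    apply continuous_Rminus; auto.
  - rewrite RInt_minus_continuous, RInt_const by assumption. reflexivity.
Qed.

Lemma Rmult_div_succ_lt (s eps : R) : 0 <= s -> 0 < eps -> s * (eps / (s + 1)) < eps.
Proof.
  intros s_nonneg eps_pos.
  assert (pos : 0 < eps / (s + 1)) by (apply Rdiv_lt_0_compat; lra).
  replace (s * (eps / (s + 1))) with (eps - eps / (s + 1)) by (field; lra). lra.
Qed.

Lemma continuous_const_closure (h : R -> R) (a b c : R) :
  a < b -> (forall t, continuous h t) -> (forall t, a < t < b -> h t = c) ->
  forall t, a <= t <= b -> h t = c.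
Proof.
  intros ab h_cont h_const t t_ab.
  destruct (Req_dec (h t) c) as [E | h_ne]; [exact E | exfalso].
  destruct (continuous_neq_0 (fun s => h s - c) t) as [d away]; [| lra |].
  { apply continuity_pt_filterlim, continuous_Rminus; [apply h_cont | apply continuous_const]. }
  assert (d_pos := cond_pos d).
  set (r := Rmin (d / 2) ((b - a) / 3)).
  assert (r_pos : 0 < r) by (apply Rmin_glb_lt; lra).
  assert (r_d : r <= d / 2) by apply Rmin_l.
  assert (r_ab : r <= (b - a) / 3) by apply Rmin_r.
  destruct (Rle_dec t ((a + b) / 2)) as [left_half | right_half].
  - apply (away r); [rewrite Rabs_pos_eq; lra |].
    rewrite h_const; lra.
  - apply (away (- r)); [rewrite Rabs_Ropp, Rabs_pos_eq; lra |].
    rewrite h_const; lra.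
Qed.

Lemma RInt_nonneg_eq_0 (h : R -> R) (a b : R) :
  a < b -> (forall t, continuous h t) -> (forall t, 0 <= h t) -> RInt h a b = 0 ->
  forall t, a <= t <= b -> h t = 0.
Proof.
  intros ab h_cont h_nonneg int0.
  apply continuous_const_closure; [exact ab | exact h_cont |].
  intros t t_ab.
  destruct (Req_dec (h t) 0) as [E | h_ne]; [exact E | exfalso].
  destruct (continuous_neq_0 h t) as [d away];
    [apply continuity_pt_filterlim, h_cont | exact h_ne |].
  assert (d_pos := cond_pos d).
  set (r := Rmin d (Rmin (t - a) (b - t))).
  assert (r_pos : 0 < r) by (repeat apply Rmin_glb_lt; lra).
  assert (r_d : r <= d) by apply Rmin_l.
  assert (r_a : r <= t - a) by (eapply Rle_trans; [apply Rmin_r | apply Rmin_l]).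
  assert (r_b : r <= b - t) by (eapply Rle_trans; [apply Rmin_r | apply Rmin_r]).
  assert (nonneg : forall p q, p <= q -> 0 <= RInt h p q).
  { intros p q pq. apply RInt_ge_0; [exact pq | | auto].
    apply ex_RInt_continuous_R, h_cont. }
  assert (near : 0 < RInt h (t - r) (t + r)).
  { apply RInt_gt_0; [lra | | auto]. intros s s_near.
    assert (hs : h s <> 0).
    { replace s with (t + (s - t)) by ring. apply away, Rabs_def1; lra. }
    assert (hs0 := h_nonneg s). lra. }
  assert (before := nonneg a (t - r) ltac:(lra)).
  assert (after := nonneg (t + r) b ltac:(lra)).
  rewrite (RInt_Chasles_continuous h a (t - r)), (RInt_Chasles_continuous h (t - r) (t + r))
    in int0 by exact h_cont.
  lra.
Qed.

(** * Goursat's theorem for closed forms on rectangles *)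

Definition half_of (I J : R * R) : Prop :=
  J = (fst I, (fst I + snd I) / 2) \/ J = ((fst I + snd I) / 2, snd I).

Lemma half_of_chain_limit (I : nat -> R * R) :
  fst (I 0%nat) <= snd (I 0%nat) -> (forall n, half_of (I n) (I (S n))) ->
  exists X, forall n, fst (I n) <= X <= snd (I n) /\
    snd (I n) - fst (I n) = (snd (I 0%nat) - fst (I 0%nat)) * (/ 2) ^ n.
Proof.
  intros I0 halving.
  assert (width : forall n,
    snd (I n) - fst (I n) = (snd (I 0%nat) - fst (I 0%nat)) * (/ 2) ^ n).
  { induction n as [| n IH]; simpl; [ring |].
    transitivity ((snd (I n) - fst (I n)) * / 2); [| rewrite IH; ring].
    destruct (halving n) as [-> | ->]; simpl; field. }
  assert (ordered : forall n, fst (I n) <= snd (I n)).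
  { intros n. assert (0 <= (snd (I 0%nat) - fst (I 0%nat)) * (/ 2) ^ n)
      by (apply Rmult_le_pos; [| apply pow_le]; lra).
    specialize (width n). lra. }
  assert (fst_incr : forall n, fst (I n) <= fst (I (S n))).
  { intros n. specialize (ordered n). destruct (halving n) as [-> | ->]; simpl; lra. }
  assert (snd_decr : forall n, snd (I (S n)) <= snd (I n)).
  { intros n. specialize (ordered n). destruct (halving n) as [-> | ->]; simpl; lra. }
  destruct (ex_lim_seq_adj (fun n => fst (I n)) (fun n => snd (I n)) fst_incr snd_decr)
    as ([X lim_fst] & [Y lim_snd] & same).
  { apply (is_lim_seq_ext (fun n => (snd (I 0%nat) - fst (I 0%nat)) * (/ 2) ^ n)).
    { intros n. symmetry. apply width. }
    replace (Finite 0) with (Rbar_mult (snd (I 0%nat) - fst (I 0%nat)) 0)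
      by (simpl; f_equal; ring).
    apply is_lim_seq_scal_l, is_lim_seq_geom. rewrite Rabs_pos_eq; lra. }
  rewrite (is_lim_seq_unique _ _ lim_fst), (is_lim_seq_unique _ _ lim_snd) in same.
  injection same as <-.
  exists X. intros n. split; [split | apply width].
  - exact (is_lim_seq_incr_compare _ _ lim_fst fst_incr n).
  - exact (is_lim_seq_decr_compare _ _ lim_snd snd_decr n).
Qed.

Lemma bisection_failing_chain (Pr : R * R -> R * R -> Prop) (I0 J0 : R * R) :
  (forall I J, (forall I' J', half_of I I' -> half_of J J' -> Pr I' J') -> Pr I J) ->
  ~ Pr I0 J0 ->
  exists I J : nat -> R * R, I 0%nat = I0 /\ J 0%nat = J0 /\
    (forall n, half_of (I n) (I (S n))) /\ (forall n, half_of (J n) (J (S n))) /\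
    forall n, ~ Pr (I n) (J n).
Proof.
  intros glue bad.
  set (bad_quadrant := fun K L : (R * R) * (R * R) => ~ Pr (fst K) (snd K) ->
    half_of (fst K) (fst L) /\ half_of (snd K) (snd L) /\ ~ Pr (fst L) (snd L)).
  assert (next : forall K, exists L, bad_quadrant K L).
  { intros [I J]. destruct (classic (Pr I J)) as [good | bad_IJ].
    - exists (I, J). intros not_good. contradiction.
    - apply NNPP. intros none. apply bad_IJ, glue. intros I' J' I_half J_half.
      apply NNPP. intros bad_half. apply none. exists (I', J'). intros _. auto. }
  destruct (functional_choice_imp_functional_dependent_choice functional_choice _ next (I0, J0))
    as (K & K0 & chain).
  assert (all_bad : forall n, ~ Pr (fst (K n)) (snd (K n))).
  { induction n as [| n IH]; [rewrite K0; exact bad | apply (chain n IH)]. }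
  exists (fun n => fst (K n)), (fun n => snd (K n)). rewrite K0.
  repeat split; intros n; try apply (chain n (all_bad n)). apply all_bad.
Qed.

Lemma rectangle_bisection (Pr : R * R -> R * R -> Prop) (I0 J0 : R * R) :
  fst I0 <= snd I0 -> fst J0 <= snd J0 ->
  (forall I J, (forall I' J', half_of I I' -> half_of J J' -> Pr I' J') -> Pr I J) ->
  (forall X Y, fst I0 <= X <= snd I0 -> fst J0 <= Y <= snd J0 ->
     exists d, 0 < d /\ forall I J, fst I <= X <= snd I -> fst J <= Y <= snd J ->
       snd I - fst I < d -> snd J - fst J < d -> Pr I J) ->
  Pr I0 J0.
Proof.
  intros I0_le J0_le glue local.
  apply NNPP. intros bad.
  destruct (bisection_failing_chain Pr I0 J0 glue bad)
    as (I & J & I_0 & J_0 & I_halving & J_halving & all_bad).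
  destruct (half_of_chain_limit I) as [X X_in]; [rewrite I_0; exact I0_le | exact I_halving |].
  destruct (half_of_chain_limit J) as [Y Y_in]; [rewrite J_0; exact J0_le | exact J_halving |].
  rewrite I_0 in X_in. rewrite J_0 in Y_in.
  destruct (local X Y) as (d & d_pos & small_good);
    [rewrite <- I_0; apply X_in | rewrite <- J_0; apply Y_in |].
  set (w := snd I0 - fst I0) in *. set (h := snd J0 - fst J0) in *.
  assert (scale_pos : 0 < w + h + 1) by (unfold w, h; lra).
  destruct (pow_lt_1_zero (/ 2)) with (y := d / (w + h + 1)) as [n pow_small];
    [rewrite Rabs_pos_eq; lra | apply Rdiv_lt_0_compat; assumption |].
  specialize (pow_small n (le_n n)).
  assert (pow_pos : 0 < (/ 2) ^ n) by (apply pow_lt; lra).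
  rewrite Rabs_pos_eq in pow_small by lra. apply Rlt_div_r in pow_small; [| exact scale_pos].
  assert (w * (/ 2) ^ n >= 0 /\ h * (/ 2) ^ n >= 0)
    by (split; apply Rle_ge, Rmult_le_pos; unfold w, h; lra).
  apply (all_bad n), small_good; try apply X_in; try apply Y_in.
  - rewrite (proj2 (X_in n)). lra.
  - rewrite (proj2 (Y_in n)). lra.
Qed.

Definition closed_form_at (P Q : R -> R -> R) (x y : R) : Prop :=
  exists Px m Qy, differentiable_pt_lim P x y Px m /\ differentiable_pt_lim Q x y m Qy.

Lemma differentiable_pt_lim_affine_approx (P : R -> R -> R) (x0 y0 Px Py eps : R) :
  differentiable_pt_lim P x0 y0 Px Py -> 0 < eps ->
  exists d, 0 < d /\ forall x y l h, Rabs (x - x0) <= l -> Rabs (y - y0) <= h -> l < d -> h < d ->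
    Rabs (P x y - P x0 y0 - (Px * (x - x0) + Py * (y - y0))) <= eps * (l + h).
Proof.
  intros P_diff eps_pos. destruct (P_diff (mkposreal eps eps_pos)) as [d near].
  exists d. split; [apply cond_pos |]. intros x y l h xl yh ld hd.
  eapply Rle_trans; [apply near; lra |]. simpl.
  apply Rmult_le_compat_l; [lra |].
  assert (Rabs (x - x0) >= 0) by apply Rle_ge, Rabs_pos.
  assert (Rabs (y - y0) >= 0) by apply Rle_ge, Rabs_pos.
  apply Rmax_lub; lra.
Qed.

Lemma continuity_2d_pt_section_l (P : R -> R -> R) (x y : R) :
  continuity_2d_pt P x y -> continuous (fun s => P s y) x.
Proof.
  intros P_cont. apply (continuous_comp_2 (fun s => s) (fun _ => y) P);
    [apply continuous_id | apply continuous_const | apply continuity_2d_pt_filterlim, P_cont].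
Qed.

Lemma continuity_2d_pt_section_r (P : R -> R -> R) (x y : R) :
  continuity_2d_pt P x y -> continuous (fun t => P x t) y.
Proof.
  intros P_cont. apply (continuous_comp_2 (fun _ => x) (fun t => t) P);
    [apply continuous_const | apply continuous_id | apply continuity_2d_pt_filterlim, P_cont].
Qed.

Section Goursat.

Variables P Q : R -> R -> R.
Hypothesis P_cont : forall x y, continuity_2d_pt P x y.
Hypothesis Q_cont : forall x y, continuity_2d_pt Q x y.

Definition circulation (I J : R * R) : R :=
  RInt (fun s => P s (fst J)) (fst I) (snd I) - RInt (fun s => P s (snd J)) (fst I) (snd I) +
  (RInt (fun t => Q (snd I) t) (fst J) (snd J) - RInt (fun t => Q (fst I) t) (fst J) (snd J)).

Lemma circulation_quadrants (I J : R * R) (xm ym : R) :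
  circulation I J =
  circulation (fst I, xm) (fst J, ym) + circulation (xm, snd I) (fst J, ym) +
  (circulation (fst I, xm) (ym, snd J) + circulation (xm, snd I) (ym, snd J)).
Proof.
  unfold circulation; simpl.
  assert (split_P : forall y, RInt (fun s => P s y) (fst I) (snd I) =
    RInt (fun s => P s y) (fst I) xm + RInt (fun s => P s y) xm (snd I)).
  { intros y. apply RInt_Chasles_continuous. intros s. apply continuity_2d_pt_section_l, P_cont. }
  assert (split_Q : forall x, RInt (fun t => Q x t) (fst J) (snd J) =
    RInt (fun t => Q x t) (fst J) ym + RInt (fun t => Q x t) ym (snd J)).
  { intros x. apply RInt_Chasles_continuous. intros t. apply continuity_2d_pt_section_r, Q_cont. }
  rewrite !split_P, !split_Q. ring.
Qed.

Lemma circulation_closed_form_small (x0 y0 eps : R) :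
  closed_form_at P Q x0 y0 -> 0 < eps ->
  exists d, 0 < d /\ forall I J, fst I <= x0 <= snd I -> fst J <= y0 <= snd J ->
    snd I - fst I < d -> snd J - fst J < d ->
    Rabs (circulation I J) <= eps * (snd I - fst I + (snd J - fst J)) ^ 2.
Proof.
  intros (Px & m & Qy & P_diff & Q_diff) eps_pos.
  destruct (differentiable_pt_lim_affine_approx P x0 y0 Px m (eps / 2) P_diff)
    as (dP & dP_pos & P_near); [lra |].
  destruct (differentiable_pt_lim_affine_approx Q x0 y0 m Qy (eps / 2) Q_diff)
    as (dQ & dQ_pos & Q_near); [lra |].
  exists (Rmin dP dQ). split; [apply Rmin_glb_lt; assumption |].
  intros [x1 x2] [y1 y2]. simpl. intros x0_in y0_in small_w small_h.
  assert (min_P := Rmin_l dP dQ). assert (min_Q := Rmin_r dP dQ).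
  set (w := x2 - x1) in *. set (h := y2 - y1) in *.
  assert (inside_x : forall x, x1 <= x <= x2 -> Rabs (x - x0) <= w)
    by (intros; apply Rabs_le; unfold w; lra).
  assert (inside_y : forall y, y1 <= y <= y2 -> Rabs (y - y0) <= h)
    by (intros; apply Rabs_le; unfold h; lra).
  assert (horizontal : Rabs (RInt (fun s => P s y1) x1 x2 - RInt (fun s => P s y2) x1 x2
                              - w * (- (m * h))) <= w * (eps * (w + h))).
  { rewrite <- RInt_minus_continuous by (intros s; apply continuity_2d_pt_section_l, P_cont).
    apply Rabs_RInt_minus_const_le; [unfold w in *; lra | |].
    - intros s. apply continuous_Rminus; apply continuity_2d_pt_section_l, P_cont.
    - intros s s_in.
      assert (lower := P_near s y1 w h (inside_x s s_in) (inside_y y1 ltac:(lra))).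
      assert (upper := P_near s y2 w h (inside_x s s_in) (inside_y y2 ltac:(lra))).
      specialize (lower ltac:(lra) ltac:(lra)). specialize (upper ltac:(lra) ltac:(lra)).
      apply Rabs_le_between in lower, upper. apply Rabs_le_between. unfold h in *. lra. }
  assert (vertical : Rabs (RInt (fun t => Q x2 t) y1 y2 - RInt (fun t => Q x1 t) y1 y2
                            - h * (m * w)) <= h * (eps * (w + h))).
  { rewrite <- RInt_minus_continuous by (intros t; apply continuity_2d_pt_section_r, Q_cont).
    apply Rabs_RInt_minus_const_le; [unfold h in *; lra | |].
    - intros t. apply continuous_Rminus; apply continuity_2d_pt_section_r, Q_cont.
    - intros t t_in.
      assert (right := Q_near x2 t w h (inside_x x2 ltac:(lra)) (inside_y t t_in)).
      assert (left := Q_near x1 t w h (inside_x x1 ltac:(lra)) (inside_y t t_in)).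
      specialize (right ltac:(lra) ltac:(lra)). specialize (left ltac:(lra) ltac:(lra)).
      apply Rabs_le_between in right, left. apply Rabs_le_between. unfold w in *. lra. }
  unfold circulation; simpl.
  apply Rabs_le_between in horizontal, vertical. apply Rabs_le_between. lra.
Qed.

(* The bound [eps * (width + height) ^ 2] is four times the bound for a quadrant,
   so it is inherited from the quadrants. *)
Lemma goursat_rectangle (I J : R * R) :
  fst I <= snd I -> fst J <= snd J ->
  (forall x y, fst I <= x <= snd I -> fst J <= y <= snd J -> closed_form_at P Q x y) ->
  circulation I J = 0.
Proof.
  intros I_le J_le closed.
  assert (small : forall eps, 0 < eps ->
    Rabs (circulation I J) <= eps * (snd I - fst I + (snd J - fst J)) ^ 2).
  { intros eps eps_pos.
    apply (rectangle_bisection (fun I J =>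
      Rabs (circulation I J) <= eps * (snd I - fst I + (snd J - fst J)) ^ 2));
      [exact I_le | exact J_le | |].
    - intros [x1 x2] [y1 y2] quadrants.
      rewrite (circulation_quadrants _ _ ((x1 + x2) / 2) ((y1 + y2) / 2)).
      assert (LL := quadrants _ _ (or_introl eq_refl) (or_introl eq_refl)).
      assert (RL := quadrants _ _ (or_intror eq_refl) (or_introl eq_refl)).
      assert (LR := quadrants _ _ (or_introl eq_refl) (or_intror eq_refl)).
      assert (RR := quadrants _ _ (or_intror eq_refl) (or_intror eq_refl)).
      simpl fst in *. simpl snd in *.
      apply Rabs_le_between in LL, RL, LR, RR. apply Rabs_le_between. lra.
    - intros X Y X_in Y_in. apply circulation_closed_form_small; auto. }
  apply Req_lt_aux. intros [eps eps_pos]. rewrite Rminus_0_r. simpl.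
  set (s := (snd I - fst I + (snd J - fst J)) ^ 2) in *.
  assert (s_nonneg : 0 <= s) by apply pow2_ge_0.
  eapply Rle_lt_trans; [apply (small (eps / (s + 1))), Rdiv_lt_0_compat; lra |].
  rewrite Rmult_comm. apply Rmult_div_succ_lt; assumption.
Qed.

End Goursat.

Lemma continuous_RInt_param (Q : R -> R -> R) (a b x : R) :
  a <= b -> (forall x y, continuity_2d_pt Q x y) ->
  continuous (fun x => RInt (fun t => Q x t) a b) x.
Proof.
  intros ab Q_cont. apply continuity_pt_filterlim. intros eps eps_pos.
  assert (scaled_pos : 0 < eps / (b - a + 1)) by (apply Rdiv_lt_0_compat; lra).
  destruct (uniform_continuity_2d_1d' Q a b x (fun t _ => Q_cont x t) (mkposreal _ scaled_pos))
    as [d near].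
  assert (d_pos := cond_pos d).
  assert (Q_slice : forall u t, continuous (fun t => Q u t) t)
    by (intros; apply continuity_2d_pt_section_r, Q_cont).
  exists d. split; [exact d_pos |]. intros u [_ u_near].
  simpl in u_near |- *. unfold Rdist in *. apply Rabs_lt_between in u_near.
  rewrite <- RInt_minus_continuous by apply Q_slice.
  apply Rle_lt_trans with ((b - a) * (eps / (b - a + 1))).
  - apply abs_RInt_le_const; [exact ab | |].
    + apply ex_RInt_continuous_R. intros t. apply continuous_Rminus; apply Q_slice.
    + intros t t_in. apply Rlt_le, near; try lra.
      rewrite Rminus_eq_0, Rabs_R0. exact d_pos.
  - apply Rmult_div_succ_lt; lra.
Qed.

Lemma closed_form_strip (P Q : R -> R -> R) (al be a b : R) :
  al < be -> a <= b ->
  (forall x y, continuity_2d_pt P x y) -> (forall x y, continuity_2d_pt Q x y) ->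
  (forall x, P x a = P x b) ->
  (forall x y, al < x < be -> closed_form_at P Q x y) ->
  RInt (fun t => Q al t) a b = RInt (fun t => Q be t) a b.
Proof.
  intros al_be ab P_cont Q_cont P_per closed.
  set (V := fun x => RInt (fun t => Q x t) a b).
  assert (inner : forall x1 x2, al < x1 -> x1 <= x2 -> x2 < be -> V x1 = V x2).
  { intros x1 x2 al_x1 x1_x2 x2_be.
    assert (circ0 := goursat_rectangle P Q P_cont Q_cont (x1, x2) (a, b) x1_x2 ab).
    unfold circulation in circ0; simpl in circ0.
    rewrite (RInt_ext (fun s => P s b) (fun s => P s a)) in circ0 by (intros; auto).
    specialize (circ0 ltac:(intros; apply closed; lra)). unfold V. lra. }
  assert (V_const : forall x, al <= x <= be -> V x = V ((al + be) / 2)).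
  { apply continuous_const_closure; [exact al_be | |].
    - intros x. apply continuous_RInt_param; assumption.
    - intros x x_in. destruct (Rle_dec x ((al + be) / 2));
        [apply inner | symmetry; apply inner]; lra. }
  transitivity (V ((al + be) / 2)); [apply V_const | symmetry; apply V_const]; lra.
Qed.

(** * Complex differentiability and continuity *)

Lemma Rabs_Im_le_Cmod (z : C) : Rabs (Im z) <= Cmod z.
Proof. eapply Rle_trans; [apply Rmax_r | apply Rmax_Cmod]. Qed.

Lemma Cmod_le_2Rmax (z : C) : Cmod z <= 2 * Rmax (Rabs (Re z)) (Rabs (Im z)).
Proof.
  eapply Rle_trans; [apply Cmod_2Rmax |]. apply Rmult_le_compat_r.
  - eapply Rle_trans; [apply Rabs_pos | apply Rmax_l].
  - rewrite <- (sqrt_square 2) at 2 by lra. apply sqrt_le_1_alt. lra.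
Qed.

Lemma is_derive_C_eps (f : C -> C) (z l : C) :
  is_derive (K := C_AbsRing) (V := C_NormedModule) f z l <->
  forall eps, 0 < eps -> exists d, 0 < d /\ forall w, Cmod (w - z) < d ->
    Cmod (f w - f z - (w - z) * l) <= eps * Cmod (w - z).
Proof.
  split.
  - intros [_ f_diff] eps eps_pos.
    destruct (f_diff z (fun P HP => HP) (mkposreal eps eps_pos)) as [d near].
    exists d. split; [apply cond_pos |]. intros w w_near. exact (near w w_near).
  - intros near. split; [apply is_linear_scal_l |].
    intros x x_lim.
    apply (is_filter_lim_locally_unique (V := AbsRing_NormedModule C_AbsRing)) in x_lim.
    subst x. intros eps.
    destruct (near eps (cond_pos eps)) as (d & d_pos & near_d). exists (mkposreal d d_pos).
    exact near_d.
Qed.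

Lemma C_linearization_error (w0 w z0 z l : C) :
  (w - w0 - (z - z0) * l)%C =
  (Re w - Re w0 - (Re l * (Re z - Re z0) + - Im l * (Im z - Im z0)),
   Im w - Im w0 - (Im l * (Re z - Re z0) + Re l * (Im z - Im z0))).
Proof.
  destruct w0, w, z0, z, l. apply injective_projections; simpl; ring.
Qed.

Lemma C_differentiable_cauchy_riemann (f : C -> C) (x y : R) :
  C_differentiable f (x, y) ->
  exists p q, differentiable_pt_lim (fun x y => Re (f (x, y))) x y p (- q) /\
              differentiable_pt_lim (fun x y => Im (f (x, y))) x y q p.
Proof.
  intros [l f_diff].
  assert (near : forall eps : posreal, locally_2d (fun u v =>
    Cmod (f (u, v) - f (x, y) - ((u, v) - (x, y)) * l) <=
    eps * Rmax (Rabs (u - x)) (Rabs (v - y))) x y).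
  { intros [eps eps_pos].
    destruct (proj1 (is_derive_C_eps _ _ _) f_diff (eps / 2)) as (d & d_pos & near_d); [lra |].
    exists (mkposreal (d / 2) ltac:(lra)). simpl. intros u v u_near v_near.
    assert (dist : Cmod ((u, v) - (x, y)) <= 2 * Rmax (Rabs (u - x)) (Rabs (v - y)))
      by apply (Cmod_le_2Rmax ((u, v) - (x, y))).
    assert (max_lt : Rmax (Rabs (u - x)) (Rabs (v - y)) < d / 2)
      by (apply Rmax_lub_lt; assumption).
    eapply Rle_trans; [apply near_d; lra |].
    replace (eps * Rmax (Rabs (u - x)) (Rabs (v - y)))
      with (eps / 2 * (2 * Rmax (Rabs (u - x)) (Rabs (v - y)))) by field.
    apply Rmult_le_compat_l; lra. }
  exists (Re l), (Im l). split; intros eps; destruct (near eps) as [d near_d]; exists d;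
    intros u v u_near v_near; (eapply Rle_trans; [| exact (near_d u v u_near v_near)]);
    rewrite C_linearization_error.
  - apply (re_le_Cmod (_, _)).
  - apply (Rabs_Im_le_Cmod (_, _)).
Qed.

Lemma cauchy_riemann_C_differentiable (f : C -> C) (x y p q : R) :
  differentiable_pt_lim (fun x y => Re (f (x, y))) x y p (- q) ->
  differentiable_pt_lim (fun x y => Im (f (x, y))) x y q p ->
  C_differentiable f (x, y).
Proof.
  intros Re_diff Im_diff. exists (p, q). apply is_derive_C_eps.
  intros eps eps_pos. set (half := mkposreal (eps / 2) ltac:(lra)).
  destruct (Re_diff half) as [d1 near1], (Im_diff half) as [d2 near2]. simpl in near1, near2.
  exists (Rmin d1 d2). split; [apply Rmin_glb_lt; apply cond_pos |].
  intros [u v] w_near.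
  assert (dist := Rmax_Cmod ((u, v) - (x, y))%C). simpl in dist. fold (u - x) (v - y) in dist.
  assert (max_l := Rmax_l (Rabs (u - x)) (Rabs (v - y))).
  assert (max_r := Rmax_r (Rabs (u - x)) (Rabs (v - y))).
  assert (min_l := Rmin_l d1 d2). assert (min_r := Rmin_r d1 d2).
  specialize (near1 u v ltac:(lra) ltac:(lra)). specialize (near2 u v ltac:(lra) ltac:(lra)).
  rewrite C_linearization_error. eapply Rle_trans; [apply Cmod_le_2Rmax |]. simpl Re. simpl Im.
  replace (eps * Cmod ((u, v) - (x, y))) with (2 * (eps / 2 * Cmod ((u, v) - (x, y)))) by field.
  apply Rmult_le_compat_l; [lra |].
  assert (eps / 2 * Rmax (Rabs (u - x)) (Rabs (v - y)) <= eps / 2 * Cmod ((u, v) - (x, y)))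
    by (apply Rmult_le_compat_l; lra).
  apply Rmax_lub; lra.
Qed.

(* [C_NormedModule] and [AbsRing_NormedModule C_AbsRing] carry different uniform structures;
   the product and chain rules of Coquelicot use the latter. *)
Lemma is_derive_C_AbsRing (f : C -> C) (z l : C) :
  is_derive (K := C_AbsRing) (V := C_NormedModule) f z l <->
  is_derive (K := C_AbsRing) (V := AbsRing_NormedModule C_AbsRing) f z l.
Proof. split; intros [_ f_diff]; (split; [apply is_linear_scal_l | exact f_diff]). Qed.

Lemma C_differentiable_comp (f g : C -> C) (z : C) :
  C_differentiable f (g z) -> C_differentiable g z -> C_differentiable (fun w => f (g w)) z.
Proof.
  intros [lf f_diff] [lg g_diff]. eexists. apply is_derive_comp; [exact f_diff |].
  apply is_derive_C_AbsRing, g_diff.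
Qed.

Lemma C_differentiable_mult (f g : C -> C) (z : C) :
  C_differentiable f z -> C_differentiable g z -> C_differentiable (fun w => f w * g w)%C z.
Proof.
  intros [lf f_diff] [lg g_diff]. eexists. apply is_derive_C_AbsRing.
  apply (is_derive_mult (K := C_AbsRing) f g);
    [apply is_derive_C_AbsRing, f_diff | apply is_derive_C_AbsRing, g_diff | exact Cmult_comm].
Qed.

Lemma C_differentiable_affine (p q z : C) : C_differentiable (fun w => p + q * w)%C z.
Proof.
  exists q. apply is_derive_C_eps. intros eps eps_pos. exists 1. split; [lra |]. intros w _.
  replace (p + q * w - (p + q * z) - (w - z) * q)%C with (RtoC 0) by ring.
  rewrite Cmod_0. apply Rmult_le_pos; [lra | apply Cmod_ge_0].
Qed.

Lemma C_differentiable_conj_conj (f : C -> C) (z : C) :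
  C_differentiable f (Cconj z) -> C_differentiable (fun w => Cconj (f (Cconj w))) z.
Proof.
  intros [l f_diff]. exists (Cconj l). apply is_derive_C_eps. intros eps eps_pos.
  destruct (proj1 (is_derive_C_eps _ _ _) f_diff eps eps_pos) as (d & d_pos & near).
  exists d. split; [exact d_pos |]. intros w.
  rewrite <- (Cmod_conj (w - z)), Cminus_conj. intros w_near.
  rewrite <- Cmod_conj, !Cminus_conj, Cmult_conj, Cminus_conj, !Cconj_conj.
  apply near, w_near.
Qed.

Lemma C_differentiable_continuous (f : C -> C) (z : C) : C_differentiable f z -> continuous f z.
Proof.
  intros f_diff P P_near. apply locally_C. exact (ex_derive_continuous f z f_diff P P_near).
Qed.

Lemma continuous_continuous_on (S : C -> Prop) (f : C -> C) :
  (forall z, continuous f z) -> continuous_on S f.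
Proof.
  intros f_cont z _. apply (filterlim_filter_le_1 f (filter_le_within S) (f_cont z)).
Qed.

Lemma continuous_on_subset (S T : C -> Prop) (f : C -> C) :
  (forall z, S z -> T z) -> continuous_on T f -> continuous_on S f.
Proof.
  intros ST f_cont z Sz P P_near.
  apply (filter_imp _ _ (fun w Pw Sw => Pw (ST w Sw)) (f_cont z (ST z Sz) P P_near)).
Qed.

Lemma continuous_on_comp (S T : C -> Prop) (f g : C -> C) :
  continuous_on S g -> continuous_on T f -> (forall z, S z -> T (g z)) ->
  continuous_on S (fun z => f (g z)).
Proof.
  intros g_cont f_cont ST z Sz P P_near.
  apply (filter_imp _ _ (fun w Pw Sw => Pw Sw (ST w Sw))
    (g_cont z Sz _ (f_cont (g z) (ST z Sz) P P_near))).
Qed.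

Lemma continuous_on_mult (S : C -> Prop) (f g : C -> C) :
  continuous_on S f -> continuous_on S g -> continuous_on S (fun z => f z * g z)%C.
Proof.
  intros f_cont g_cont z Sz.
  apply (filterlim_comp_2 f g Cmult (f_cont z Sz) (g_cont z Sz)).
  intros P P_near. apply locally_C in P_near.
  destruct (filterlim_mult (K := C_AbsRing) (f z) (g z) P P_near) as [U V U_near V_near UV].
  exists U V; [apply locally_C, U_near | apply locally_C, V_near | exact UV].
Qed.

Lemma continuous_coordinatewise (phi psi : R -> R) (z : C) :
  (forall x, continuous phi x) -> (forall y, continuous psi y) ->
  continuous (fun w : C => ((phi (Re w), psi (Im w)) : C)) z.
Proof.
  intros phi_cont psi_cont P [eps near].
  destruct (phi_cont (Re z) _ (locally_ball (phi (Re z)) eps)) as [d1 near1].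
  destruct (psi_cont (Im z) _ (locally_ball (psi (Im z)) eps)) as [d2 near2].
  assert (d_pos : 0 < Rmin d1 d2) by (apply Rmin_glb_lt; apply cond_pos).
  exists (mkposreal _ d_pos). intros w [Re_near Im_near]. apply near. split.
  - apply near1. eapply ball_le; [apply Rmin_l | exact Re_near].
  - apply near2. eapply ball_le; [apply Rmin_r | exact Im_near].
Qed.

Lemma continuous_Cconj (z : C) : continuous Cconj z.
Proof.
  apply (continuous_coordinatewise (fun x => x) Ropp);
    [apply continuous_id | intros y; apply (continuous_opp (V := R_NormedModule)), continuous_id].
Qed.

Lemma continuity_2d_pt_Re (f : C -> C) (x y : R) :
  continuous f (x, y) -> continuity_2d_pt (fun x y => Re (f (x, y))) x y.
Proof.
  intros f_cont eps.
  destruct (f_cont _ (locally_ball (f (x, y)) eps)) as [d near].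
  exists d. intros u v u_near v_near. apply (near (u, v)). split; assumption.
Qed.

Lemma continuity_2d_pt_Im (f : C -> C) (x y : R) :
  continuous f (x, y) -> continuity_2d_pt (fun x y => Im (f (x, y))) x y.
Proof.
  intros f_cont eps.
  destruct (f_cont _ (locally_ball (f (x, y)) eps)) as [d near].
  exists d. intros u v u_near v_near. apply (near (u, v)). split; assumption.
Qed.

(** * Periodic holomorphic functions on a strip *)

Definition closed_strip (al be : R) (z : C) : Prop := al <= Re z <= be.
Definition open_strip (al be : R) (z : C) : Prop := al < Re z < be.

Definition periodic_holomorphic (al be a b : R) (Phi : C -> C) : Prop :=
  continuous_on (closed_strip al be) Phi /\
  holomorphic_on (open_strip al be) Phi /\
  forall x, al <= x <= be -> Phi (x, a) = Phi (x, b).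

Lemma periodic_holomorphic_substrip (al be al' be' a b : R) (Phi : C -> C) :
  al <= al' -> be' <= be ->
  periodic_holomorphic al be a b Phi -> periodic_holomorphic al' be' a b Phi.
Proof.
  intros al_le be_le (Phi_cont & Phi_hol & Phi_per). split; [| split].
  - apply (continuous_on_subset _ (closed_strip al be)); [| exact Phi_cont].
    unfold closed_strip. intros z z_in. lra.
  - intros z z_in. apply Phi_hol. unfold open_strip in *. lra.
  - intros x x_in. apply Phi_per. lra.
Qed.

Lemma periodic_holomorphic_mult (al be a b : R) (Phi Psi : C -> C) :
  periodic_holomorphic al be a b Phi -> periodic_holomorphic al be a b Psi ->
  periodic_holomorphic al be a b (fun u => Phi u * Psi u)%C.
Proof.
  intros (Phi_cont & Phi_hol & Phi_per) (Psi_cont & Psi_hol & Psi_per). split; [| split].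
  - apply continuous_on_mult; assumption.
  - intros z z_in. apply C_differentiable_mult; auto.
  - intros x x_in. rewrite Phi_per, Psi_per by exact x_in. reflexivity.
Qed.

Lemma periodic_holomorphic_conj_conj (al be r : R) (Phi : C -> C) :
  periodic_holomorphic al be (- r) r Phi ->
  periodic_holomorphic al be (- r) r (fun u => Cconj (Phi (Cconj u))).
Proof.
  intros (Phi_cont & Phi_hol & Phi_per). split; [| split].
  - apply (continuous_on_comp _ (fun _ => True) Cconj (fun u => Phi (Cconj u)));
      [| apply continuous_continuous_on, continuous_Cconj | easy].
    apply (continuous_on_comp _ (closed_strip al be));
      [apply continuous_continuous_on, continuous_Cconj | exact Phi_cont | easy].
  - intros z z_in. apply C_differentiable_conj_conj, Phi_hol, z_in.
  - intros x x_in. unfold Cconj; simpl. rewrite Ropp_involutive, Phi_per by exact x_in. reflexivity.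
Qed.

Definition mirror (m : R) (u : C) : C := (2 * m - Re u, Im u).

Lemma continuous_mirror (m : R) (u : C) : continuous (mirror m) u.
Proof.
  apply (continuous_coordinatewise (fun x => 2 * m - x) (fun y => y)); [| apply continuous_id].
  intros x. apply continuous_Rminus; [apply continuous_const | apply continuous_id].
Qed.

Lemma C_differentiable_conj_mirror (m : R) (Phi : C -> C) (u : C) :
  C_differentiable Phi (mirror m u) -> C_differentiable (fun u => Cconj (Phi (mirror m u))) u.
Proof.
  assert (mirrorE : forall u, mirror m u = Cconj (RtoC (2 * m) + RtoC (-1) * u)).
  { intros [x y]. unfold mirror, Cconj. apply injective_projections; simpl; ring. }
  intros Phi_diff.
  apply (ex_derive_ext (V := C_NormedModule)
    (fun u => Cconj (Phi (Cconj (RtoC (2 * m) + RtoC (-1) * u))))).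
  - intros w. rewrite mirrorE. reflexivity.
  - apply (C_differentiable_comp (fun v => Cconj (Phi (Cconj v))));
      [| apply C_differentiable_affine].
    apply C_differentiable_conj_conj. rewrite <- mirrorE. exact Phi_diff.
Qed.

Lemma periodic_holomorphic_conj_mirror (al be a b m : R) (Phi : C -> C) :
  periodic_holomorphic al be a b Phi ->
  periodic_holomorphic (2 * m - be) (2 * m - al) a b (fun u => Cconj (Phi (mirror m u))).
Proof.
  intros (Phi_cont & Phi_hol & Phi_per). split; [| split].
  - apply (continuous_on_comp _ (fun _ => True) Cconj (fun u => Phi (mirror m u)));
      [| apply continuous_continuous_on, continuous_Cconj | easy].
    apply (continuous_on_comp _ (closed_strip al be));
      [apply continuous_continuous_on, continuous_mirror | exact Phi_cont |].
    unfold closed_strip, mirror. simpl. intros u u_in. lra.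
  - intros u u_in. apply C_differentiable_conj_mirror, Phi_hol.
    unfold open_strip, mirror in *. simpl. lra.
  - intros x x_in. unfold mirror; simpl. rewrite Phi_per by lra. reflexivity.
Qed.

Definition clamp (al be x : R) : R := (al + be + Rabs (x - al) - Rabs (x - be)) / 2.

Lemma clamp_bounds (al be x : R) : al <= be -> al <= clamp al be x <= be.
Proof. intros al_be. unfold clamp, Rabs. repeat destruct Rcase_abs; lra. Qed.

Lemma clamp_id (al be x : R) : al <= x <= be -> clamp al be x = x.
Proof. intros x_in. unfold clamp. rewrite Rabs_pos_eq, Rabs_left1; lra. Qed.

Lemma continuous_clamp (al be x : R) : continuous (clamp al be) x.
Proof. apply continuity_pt_filterlim. unfold clamp. reg. Qed.

Definition clamp_extension (al be : R) (Phi : C -> C) (z : C) : C :=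
  Phi (clamp al be (Re z), Im z).

Lemma clamp_extension_id (al be : R) (Phi : C -> C) (z : C) :
  closed_strip al be z -> clamp_extension al be Phi z = Phi z.
Proof.
  intros z_in. unfold clamp_extension. rewrite clamp_id by exact z_in.
  destruct z. reflexivity.
Qed.

Lemma continuous_clamp_extension (al be : R) (Phi : C -> C) (z : C) :
  al <= be -> continuous_on (closed_strip al be) Phi -> continuous (clamp_extension al be Phi) z.
Proof.
  intros al_be Phi_cont.
  assert (ext_cont : continuous_on (fun _ => True) (clamp_extension al be Phi)).
  { apply (continuous_on_comp _ (closed_strip al be) Phi); [| exact Phi_cont |].
    - apply continuous_continuous_on. intros w.
      apply (continuous_coordinatewise (clamp al be) (fun y => y));
        [apply continuous_clamp | apply continuous_id].
    - intros w _. apply clamp_bounds, al_be. }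
  intros P P_near. exact (filter_imp _ _ (fun w Pw => Pw I) (ext_cont z I P P_near)).
Qed.

Lemma C_differentiable_clamp_extension (al be : R) (Phi : C -> C) (z : C) :
  open_strip al be z -> C_differentiable Phi z -> C_differentiable (clamp_extension al be Phi) z.
Proof.
  intros [al_z z_be]. apply (ex_derive_ext_loc (V := C_NormedModule)).
  assert (d_pos : 0 < Rmin (Re z - al) (be - Re z)) by (apply Rmin_glb_lt; lra).
  exists (mkposreal _ d_pos). intros w w_near. symmetry. apply clamp_extension_id.
  assert (near := Rle_lt_trans _ _ _ (re_le_Cmod _) w_near). simpl in near.
  assert (min_l := Rmin_l (Re z - al) (be - Re z)).
  assert (min_r := Rmin_r (Re z - al) (be - Re z)).
  apply Rabs_lt_between in near. unfold closed_strip, Re in *. lra.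
Qed.

Lemma continuous_strip_Re_section (al be x t : R) (Phi : C -> C) :
  al <= x <= be -> continuous_on (closed_strip al be) Phi ->
  continuous (fun t => Re (Phi (x, t))) t.
Proof.
  intros x_in Phi_cont.
  apply (continuous_ext (fun t => Re (clamp_extension al be Phi (x, t)))).
  - intros s. rewrite clamp_extension_id by exact x_in. reflexivity.
  - apply (continuity_2d_pt_section_r (fun x t => Re (clamp_extension al be Phi (x, t)))).
    apply continuity_2d_pt_Re, continuous_clamp_extension; [lra | exact Phi_cont].
Qed.

(* By the Cauchy-Riemann equations the imaginary part [Im Phi dx + Re Phi dy] of [Phi dz]
   is closed. *)
Lemma RInt_Re_periodic_holomorphic (al be a b : R) (Phi : C -> C) :
  al <= be -> a <= b -> periodic_holomorphic al be a b Phi ->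
  RInt (fun y => Re (Phi (al, y))) a b = RInt (fun y => Re (Phi (be, y))) a b.
Proof.
  intros [al_be | ->] ab (Phi_cont & Phi_hol & Phi_per); [| reflexivity].
  set (E := clamp_extension al be Phi).
  assert (E_id : forall x y, al <= x <= be -> E (x, y) = Phi (x, y))
    by (intros x y x_in; apply clamp_extension_id, x_in).
  assert (E_cont : forall z, continuous E z)
    by (intros z; apply continuous_clamp_extension; [lra | exact Phi_cont]).
  transitivity (RInt (fun y => Re (E (al, y))) a b);
    [apply RInt_ext; intros; rewrite E_id by lra; reflexivity |].
  transitivity (RInt (fun y => Re (E (be, y))) a b);
    [| apply RInt_ext; intros; rewrite E_id by lra; reflexivity].
  apply (closed_form_strip (fun x y => Im (E (x, y))) (fun x y => Re (E (x, y)))).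
  - exact al_be.
  - exact ab.
  - intros x y. apply continuity_2d_pt_Im, E_cont.
  - intros x y. apply continuity_2d_pt_Re, E_cont.
  - intros x. unfold E, clamp_extension; simpl. rewrite Phi_per; [reflexivity |].
    apply clamp_bounds; lra.
  - intros x y x_in.
    destruct (C_differentiable_cauchy_riemann E x y) as (p & q & Re_diff & Im_diff).
    + apply C_differentiable_clamp_extension; [exact x_in | apply Phi_hol, x_in].
    + exists q, p, (- q). auto.
Qed.

Definition right_decaying (x0 : R) (Phi : C -> C) : Prop :=
  forall eps, 0 < eps -> exists X, x0 <= X /\ forall y, Cmod (Phi (X, y)) <= eps.

Lemma RInt_Re_halfstrip_zero (x0 a b : R) (Phi : C -> C) :
  a <= b -> (forall X, x0 <= X -> periodic_holomorphic x0 X a b Phi) ->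
  right_decaying x0 Phi ->
  RInt (fun y => Re (Phi (x0, y))) a b = 0.
Proof.
  intros ab Phi_per decay. apply Req_lt_aux. intros [eps eps_pos]. rewrite Rminus_0_r. simpl.
  destruct (decay (eps / (b - a + 1))) as (X & X_ge & small); [apply Rdiv_lt_0_compat; lra |].
  rewrite (RInt_Re_periodic_holomorphic x0 X a b Phi X_ge ab (Phi_per X X_ge)).
  apply Rle_lt_trans with ((b - a) * (eps / (b - a + 1))).
  - apply abs_RInt_le_const; [exact ab | |].
    + apply ex_RInt_continuous_R. intros t.
      apply (continuous_strip_Re_section x0 X); [lra | apply (Phi_per X X_ge)].
    + intros y _. eapply Rle_trans; [apply re_le_Cmod | apply small].
  - apply Rmult_div_succ_lt; lra.
Qed.

Lemma RInt_Cmod_sqr_zero (al be a b x : R) (Phi Psi : C -> C) :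
  al <= x <= be -> a < b -> continuous_on (closed_strip al be) Psi ->
  (forall y, Psi (x, y) = (Phi (x, y) * Cconj (Phi (x, y)))%C) ->
  RInt (fun y => Re (Psi (x, y))) a b = 0 ->
  forall y, a <= y <= b -> Phi (x, y) = RtoC 0.
Proof.
  intros x_in ab Psi_cont Psi_sqr int0 y y_in.
  assert (Re_Psi : forall t, Re (Psi (x, t)) = Cmod (Phi (x, t)) ^ 2)
    by (intros t; rewrite Psi_sqr, <- Cmod2_conj; reflexivity).
  apply Cmod_eq_0. apply (Rsqr_0_uniq). rewrite Rsqr_pow2, <- Re_Psi.
  apply (RInt_nonneg_eq_0 (fun t => Re (Psi (x, t))) a b);
    [exact ab | | | exact int0 | exact y_in].
  - intros t. exact (continuous_strip_Re_section al be x t Psi x_in Psi_cont).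
  - intros t. rewrite Re_Psi. apply pow2_ge_0.
Qed.

(* [int |Phi (x + i y)| ^ 2 dy] is the integral over [Re u = x] of the periodic holomorphic
   function [Phi u * conj (Phi (2 x - conj u))], which vanishes on [Re u = al]. *)
Lemma periodic_holomorphic_zero_left_half (al be a b : R) (Phi : C -> C) :
  a < b -> periodic_holomorphic al be a b Phi ->
  (forall y, a <= y <= b -> Phi (al, y) = RtoC 0) ->
  forall x y, al <= x <= (al + be) / 2 -> a <= y <= b -> Phi (x, y) = RtoC 0.
Proof.
  intros ab Phi_per edge0 x y x_in y_in. revert y y_in.
  set (Psi := fun u => (Phi u * Cconj (Phi (mirror x u)))%C).
  assert (Psi_per : periodic_holomorphic al x a b Psi).
  { apply periodic_holomorphic_mult.
    - apply (periodic_holomorphic_substrip al be); [lra | lra | exact Phi_per].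
    - apply (periodic_holomorphic_substrip (2 * x - be) (2 * x - al)); [lra | lra |].
      apply periodic_holomorphic_conj_mirror, Phi_per. }
  apply (RInt_Cmod_sqr_zero al x a b x Phi Psi); [lra | exact ab | apply Psi_per | |].
  - intros y. unfold Psi, mirror; simpl. replace (2 * x - x) with x by ring. reflexivity.
  - rewrite <- (RInt_Re_periodic_holomorphic al x a b Psi ltac:(lra) ltac:(lra) Psi_per).
    rewrite (RInt_ext _ (fun _ => 0)).
    + rewrite RInt_const. apply Rmult_0_r.
    + rewrite Rmin_left, Rmax_right by lra. intros y y_in.
      unfold Psi. rewrite edge0, Cmult_0_l by lra. reflexivity.
Qed.

Lemma periodic_holomorphic_zero_interior (al be a b : R) (Phi : C -> C) :
  a < b -> periodic_holomorphic al be a b Phi ->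
  (forall y, a <= y <= b -> Phi (al, y) = RtoC 0) ->
  forall x y, al <= x < be -> a <= y <= b -> Phi (x, y) = RtoC 0.
Proof.
  intros ab Phi_per edge0 x y [al_x x_be] y_in.
  assert (halvings : forall n al, be - al <= 2 ^ n * (be - x) -> al <= x ->
    periodic_holomorphic al be a b Phi ->
    (forall y, a <= y <= b -> Phi (al, y) = RtoC 0) -> Phi (x, y) = RtoC 0).
  { induction n as [| n IH]; clear al al_x Phi_per edge0; simpl;
      intros al dist al_x Phi_per edge0.
    - replace x with al by lra. apply edge0, y_in.
    - assert (left0 := periodic_holomorphic_zero_left_half al be a b Phi ab Phi_per edge0).
      destruct (Rle_dec x ((al + be) / 2)) as [x_left | x_right]; [apply left0; lra |].
      apply (IH ((al + be) / 2)); [lra | lra | |].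
      + apply (periodic_holomorphic_substrip al be); [lra | lra | exact Phi_per].
      + intros t t_in. apply left0; lra. }
  destruct (Pow_x_infinity 2) with (b := (be - al) / (be - x)) as [n large];
    [rewrite Rabs_pos_eq; lra |].
  specialize (large n (le_n n)).
  rewrite Rabs_pos_eq in large by (apply pow_le; lra).
  apply Rge_le, Rle_div_l in large; [| lra].
  apply (halvings n al); [exact large | exact al_x | exact Phi_per | exact edge0].
Qed.

Lemma periodic_holomorphic_zero (al be a b : R) (Phi : C -> C) :
  al < be -> a < b -> periodic_holomorphic al be a b Phi ->
  (forall y, a <= y <= b -> Phi (al, y) = RtoC 0) ->
  forall x y, al <= x <= be -> a <= y <= b -> Phi (x, y) = RtoC 0.
Proof.
  intros al_be ab Phi_per edge0 x y x_in y_in.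
  set (E := clamp_extension al be Phi).
  assert (E_cont : forall z, continuous E z)
    by (intros z; apply continuous_clamp_extension; [lra | apply Phi_per]).
  assert (E0 : forall t, al < t < be -> E (t, y) = RtoC 0).
  { intros t t_in. unfold E. rewrite clamp_extension_id by (unfold closed_strip; simpl; lra).
    apply (periodic_holomorphic_zero_interior al be a b); [exact ab | exact Phi_per | exact edge0
      | lra | exact y_in]. }
  rewrite <- (clamp_extension_id al be) by exact x_in.
  apply injective_projections.
  - apply (continuous_const_closure (fun t => Re (E (t, y))) al be 0);
      [exact al_be | | | exact x_in].
    + intros t. apply (continuity_2d_pt_section_l (fun t y => Re (E (t, y)))).
      apply continuity_2d_pt_Re, E_cont.
    + intros t t_in. rewrite E0 by exact t_in. reflexivity.
  - apply (continuous_const_closure (fun t => Im (E (t, y))) al be 0);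
      [exact al_be | | | exact x_in].
    + intros t. apply (continuity_2d_pt_section_l (fun t y => Im (E (t, y)))).
      apply continuity_2d_pt_Im, E_cont.
    + intros t t_in. rewrite E0 by exact t_in. reflexivity.
Qed.

(** * Elliptic coordinates *)

Lemma cosh_sqr (x : R) : cosh x ^ 2 = 1 + sinh x ^ 2.
Proof.
  assert (E : exp x * exp (- x) = 1) by (rewrite <- exp_plus, Rplus_opp_r; apply exp_0).
  unfold cosh, sinh. nra.
Qed.

Lemma cosh_pos (x : R) : 0 < cosh x.
Proof.
  assert (pos := exp_pos x). assert (pos' := exp_pos (- x)). unfold cosh. lra.
Qed.

Lemma sinh_pos (x : R) : 0 < x -> 0 < sinh x.
Proof. rewrite <- sinh_0 at 2. apply sinh_lt. Qed.

Lemma half_le_sinh (x : R) : 0 <= x -> x / 2 <= sinh x.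
Proof.
  intros x_nonneg.
  assert (exp_ge : 1 + x <= exp x) by apply exp_ineq1_le.
  assert (exp_le : exp (- x) <= 1).
  { rewrite exp_Ropp, <- Rinv_1. apply Rinv_le_contravar; lra. }
  unfold sinh. lra.
Qed.

Definition ccosh (u : C) : C := (cosh (Re u) * cos (Im u), sinh (Re u) * sin (Im u)).

Lemma differentiable_pt_lim_separate_mult (g h : R -> R) (x y dg dh : R) :
  derivable_pt_lim g x dg -> derivable_pt_lim h y dh ->
  differentiable_pt_lim (fun u v => g u * h v) x y (dg * h y) (g x * dh).
Proof.
  intros g_diff h_diff. apply filterdiff_differentiable_pt_lim.
  apply is_derive_Reals in g_diff, h_diff.
  apply (filterdiff_ext_lin _ (fun u : R * R => fst u * dg * h y + g x * (snd u * dh))).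
  - apply (filterdiff_mult_fct (K := R_AbsRing)
      (fun u : R * R => g (fst u)) (fun u => h (snd u)) (x, y)
      (fun u => fst u * dg) (fun u => snd u * dh)); [exact Rmult_comm | |].
    + apply (filterdiff_comp' fst g (x, y) fst (fun s => s * dg));
        [apply filterdiff_linear, is_linear_fst | exact g_diff].
    + apply (filterdiff_comp' snd h (x, y) snd (fun s => s * dh));
        [apply filterdiff_linear, is_linear_snd | exact h_diff].
  - intros [s t]. change (s * dg * h y + g x * (t * dh) = s * (dg * h y) + t * (g x * dh)). ring.
Qed.

Lemma C_differentiable_ccosh (u : C) : C_differentiable ccosh u.
Proof.
  destruct u as [x y].
  apply (cauchy_riemann_C_differentiable ccosh x y (sinh x * cos y) (cosh x * sin y)).
  - replace (- (cosh x * sin y)) with (cosh x * - sin y) by ring.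
    apply (differentiable_pt_lim_separate_mult cosh cos);
      [apply derivable_pt_lim_cosh | apply derivable_pt_lim_cos].
  - apply (differentiable_pt_lim_separate_mult sinh sin);
      [apply derivable_pt_lim_sinh | apply derivable_pt_lim_sin].
Qed.

Lemma ccosh_prescribed (X Y : R) (z : C) :
  1 <= X -> -1 <= Y <= 1 -> X * Y = Re z -> (X ^ 2 - 1) * (1 - Y²) = (Im z)² ->
  exists x y, 0 <= x /\ - PI <= y <= PI /\ ccosh (x, y) = z.
Proof.
  intros X_ge Y_in XY XY_sin.
  set (x := arcsinh (sqrt (X ^ 2 - 1))).
  assert (sinh_x : sinh x = sqrt (X ^ 2 - 1)) by apply sinh_arcsinh.
  assert (x_nonneg : 0 <= x) by (unfold x; rewrite <- arcsinh_0; apply arcsinh_le, sqrt_pos).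
  assert (cosh_x : cosh x = X).
  { assert (cosh_x_pos := cosh_pos x). assert (sqr := cosh_sqr x).
    rewrite sinh_x, pow2_sqrt in sqr by nra. nra. }
  assert (sinh_sin : sinh x * sin (acos Y) = Rabs (Im z)).
  { rewrite sinh_x, sin_acos, <- sqrt_mult_alt, XY_sin by (assumption || nra).
    apply sqrt_Rsqr_abs. }
  assert (acos_in := acos_bound Y).
  destruct (Rle_dec 0 (Im z)) as [Im_nonneg | Im_neg].
  - exists x, (acos Y). split; [exact x_nonneg | split; [lra |]].
    apply injective_projections; simpl.
    + rewrite cosh_x, cos_acos by exact Y_in. exact XY.
    + rewrite sinh_sin. apply Rabs_pos_eq, Im_nonneg.
  - exists x, (- acos Y). split; [exact x_nonneg | split; [lra |]].
    apply injective_projections; simpl.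
    + rewrite cos_neg, cosh_x, cos_acos by exact Y_in. exact XY.
    + rewrite sin_neg, Ropp_mult_distr_r_reverse, sinh_sin, Rabs_left by lra.
      apply Ropp_involutive.
Qed.

(* [cosh x] and [cos y] are half the sum and half the difference of the distances from [z]
   to the foci [-1] and [1]. *)
Lemma ccosh_onto (z : C) : exists x y, 0 <= x /\ - PI <= y <= PI /\ ccosh (x, y) = z.
Proof.
  set (A := Cmod (z + 1)). set (B := Cmod (z - 1)).
  assert (A_sqr : A ^ 2 = (Re z + 1) ^ 2 + Im z ^ 2)
    by (unfold A; rewrite Cmod2_alt; destruct z; simpl; ring).
  assert (B_sqr : B ^ 2 = (Re z - 1) ^ 2 + Im z ^ 2)
    by (unfold B; rewrite Cmod2_alt; destruct z; simpl; ring).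
  assert (Cmod_2 : Cmod 2 = 2) by (rewrite Cmod_R; apply Rabs_pos_eq; lra).
  assert (foci_le : 2 <= A + B).
  { rewrite <- Cmod_2. replace (RtoC 2) with (z + 1 + - (z - 1))%C by ring.
    eapply Rle_trans; [apply Cmod_triangle |]. rewrite Cmod_opp. apply Rle_refl. }
  assert (A_le : A <= B + 2).
  { unfold A. rewrite <- Cmod_2. replace (z + 1)%C with (z - 1 + 2)%C by ring.
    apply Cmod_triangle. }
  assert (B_le : B <= A + 2).
  { unfold B. rewrite <- Cmod_2, <- (Cmod_opp 2). replace (z - 1)%C with (z + 1 + - (2))%C by ring.
    apply Cmod_triangle. }
  apply (ccosh_prescribed ((A + B) / 2) ((A - B) / 2)); unfold Rsqr; nra.
Qed.

Lemma Cmod_rotation (th : R) : Cmod (cos th, sin th) = 1.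
Proof.
  rewrite <- sqrt_1. unfold Cmod. f_equal. simpl.
  assert (unit := sin2_cos2 th). unfold Rsqr in unit. lra.
Qed.

Lemma rotation_inverse (th : R) : ((cos th, sin th) * (cos th, (- sin th)%R))%C = RtoC 1.
Proof.
  assert (unit := sin2_cos2 th). unfold Rsqr in unit.
  apply injective_projections; simpl; lra.
Qed.

Definition ell_map (c : C) (k th : R) (u : C) : C :=
  (c + (cos th, sin th) * RtoC k * ccosh u)%C.

Lemma C_differentiable_ell_map (c : C) (k th : R) (u : C) :
  C_differentiable (ell_map c k th) u.
Proof.
  apply (C_differentiable_comp (fun w => c + (cos th, sin th) * RtoC k * w)%C ccosh);
    [apply C_differentiable_affine | apply C_differentiable_ccosh].
Qed.

Lemma ell_map_periodic (c : C) (k th x : R) : ell_map c k th (x, - PI) = ell_map c k th (x, PI).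
Proof.
  unfold ell_map, ccosh; simpl. rewrite cos_neg, sin_neg, sin_PI, Ropp_0. reflexivity.
Qed.

Lemma ell_map_fold (c : C) (k th y : R) :
  ell_map c k th (0, - y) = ell_map c k th (0, y).
Proof.
  unfold ell_map, ccosh; simpl. rewrite sinh_0, cos_neg, !Rmult_0_l. reflexivity.
Qed.

Lemma ell_map_onto (c : C) (k th : R) (z : C) :
  0 < k -> exists x y, 0 <= x /\ - PI <= y <= PI /\ ell_map c k th (x, y) = z.
Proof.
  intros k_pos. assert (k_ne : RtoC k <> 0) by (intros k0; injection k0; lra).
  destruct (ccosh_onto ((z - c) * (cos th, (- sin th)%R) / RtoC k))
    as (x & y & x_nonneg & y_in & E).
  exists x, y. split; [exact x_nonneg | split; [exact y_in |]].
  unfold ell_map. rewrite E.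
  transitivity (c + (z - c) * ((cos th, sin th) * (cos th, (- sin th)%R)))%C;
    [field; exact k_ne | rewrite rotation_inverse; ring].
Qed.

Lemma ell_q_ell_map (c : C) (a b k th x y : R) :
  ell_q c a b th (ell_map c k th (x, y)) =
  (k * cosh x * cos y / a) ^ 2 + (k * sinh x * sin y / b) ^ 2.
Proof.
  unfold ell_q, ell_map.
  replace ((c + (cos th, sin th) * RtoC k * ccosh (x, y) - c) * (cos th, (- sin th)%R))%C
    with (RtoC k * ccosh (x, y))%C.
  - simpl. unfold Rdiv. ring.
  - transitivity (RtoC k * ccosh (x, y) * ((cos th, sin th) * (cos th, (- sin th)%R)))%C;
      [rewrite rotation_inverse; ring | ring].
Qed.

Lemma ell_q_ell_map_lt (c : C) (a b k th x x' y : R) :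
  0 < a -> 0 < b -> 0 < k -> 0 <= x < x' ->
  ell_q c a b th (ell_map c k th (x, y)) < ell_q c a b th (ell_map c k th (x', y)).
Proof.
  intros a_pos b_pos k_pos x_lt. rewrite !ell_q_ell_map.
  set (weight := (k * cos y / a) ^ 2 + (k * sin y / b) ^ 2).
  assert (split_q : forall s, (k * cosh s * cos y / a) ^ 2 + (k * sinh s * sin y / b) ^ 2 =
    (k * cos y / a) ^ 2 + sinh s ^ 2 * weight).
  { intros s. transitivity (cosh s ^ 2 * (k * cos y / a) ^ 2 + sinh s ^ 2 * (k * sin y / b) ^ 2);
      [field; lra | rewrite cosh_sqr; unfold weight; ring]. }
  rewrite !split_q. apply Rplus_lt_compat_l, Rmult_lt_compat_r.
  - assert (cos_nonneg := pow2_ge_0 (k * cos y / a)).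
    assert (sin_nonneg := pow2_ge_0 (k * sin y / b)).
    assert (scaled_ne : forall s t, 0 < t -> s <> 0 -> k * s / t <> 0).
    { intros s t t_pos s_ne. unfold Rdiv. repeat apply Rmult_integral_contrapositive_currified;
        [lra | exact s_ne | apply Rinv_neq_0_compat; lra]. }
    unfold weight. destruct (cos_sin_0_var y) as [cos_ne | sin_ne].
    + assert (pos := pow2_gt_0 _ (scaled_ne _ _ a_pos cos_ne)). lra.
    + assert (pos := pow2_gt_0 _ (scaled_ne _ _ b_pos sin_ne)). lra.
  - assert (sinh x < sinh x') by (apply sinh_lt; lra).
    assert (half_le := half_le_sinh x ltac:(lra)). nra.
Qed.

Lemma focal_parameters (a b : R) :
  0 < b -> b < a -> exists k x0, 0 < k /\ 0 < x0 /\ a = k * cosh x0 /\ b = k * sinh x0.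
Proof.
  intros b_pos b_a.
  assert (k_pos : 0 < sqrt (a ^ 2 - b ^ 2)) by (apply sqrt_lt_R0; nra).
  assert (k_sqr : sqrt (a ^ 2 - b ^ 2) ^ 2 = a ^ 2 - b ^ 2) by (apply pow2_sqrt; nra).
  set (k := sqrt (a ^ 2 - b ^ 2)) in *.
  set (x0 := arcsinh (b / k)).
  assert (sinh_x0 : sinh x0 = b / k) by apply sinh_arcsinh.
  exists k, x0. split; [exact k_pos |]. split; [| split].
  - unfold x0. rewrite <- arcsinh_0. apply arcsinh_lt, Rdiv_lt_0_compat; assumption.
  - assert (cosh_x0_pos := cosh_pos x0).
    assert (sqr : (k * cosh x0) ^ 2 = a ^ 2).
    { rewrite Rpow_mult_distr, cosh_sqr, sinh_x0. transitivity (k ^ 2 + b ^ 2); [field |]; lra. }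
    assert (0 < k * cosh x0) by (apply Rmult_lt_0_compat; assumption). nra.
  - rewrite sinh_x0. field. lra.
Qed.

Lemma ell_q_ell_map_curve (c : C) (k x0 th y : R) :
  0 < k -> 0 < x0 -> ell_q c (k * cosh x0) (k * sinh x0) th (ell_map c k th (x0, y)) = 1.
Proof.
  intros k_pos x0_pos. rewrite ell_q_ell_map.
  assert (cosh_x0_pos := cosh_pos x0). assert (sinh_x0_pos := sinh_pos x0 x0_pos).
  assert (unit := sin2_cos2 y). unfold Rsqr in unit.
  transitivity (cos y ^ 2 + sin y ^ 2); [field; repeat split; lra | lra].
Qed.

Lemma ell_q_ell_map_compare (c : C) (k x0 th x y : R) :
  0 < k -> 0 < x0 -> 0 <= x ->
  (ell_q c (k * cosh x0) (k * sinh x0) th (ell_map c k th (x, y)) < 1 <-> x < x0) /\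
  (1 < ell_q c (k * cosh x0) (k * sinh x0) th (ell_map c k th (x, y)) <-> x0 < x).
Proof.
  intros k_pos x0_pos x_nonneg.
  assert (a_pos : 0 < k * cosh x0) by (apply Rmult_lt_0_compat; [exact k_pos | apply cosh_pos]).
  assert (b_pos : 0 < k * sinh x0)
    by (apply Rmult_lt_0_compat; [exact k_pos | apply sinh_pos, x0_pos]).
  assert (curve := ell_q_ell_map_curve c k x0 th y k_pos x0_pos).
  assert (increasing := fun s t => ell_q_ell_map_lt c _ _ k th s t y a_pos b_pos k_pos).
  destruct (Rtotal_order x x0) as [lt | [-> | gt]].
  - specialize (increasing x x0 ltac:(lra)). lra.
  - lra.
  - specialize (increasing x0 x ltac:(lra)). lra.
Qed.

Lemma Cmod_ell_map_ge (c : C) (k th x y : R) :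
  0 < k -> 0 <= x -> k * (x / 2) - Cmod c <= Cmod (ell_map c k th (x, y)).
Proof.
  intros k_pos x_nonneg. assert (half_le := half_le_sinh x x_nonneg).
  assert (ccosh_ge : sinh x <= Cmod (ccosh (x, y))).
  { apply Rsqr_incr_0_var; [| apply Cmod_ge_0]. rewrite !Rsqr_pow2, Cmod2_alt. simpl Re. simpl Im.
    assert (unit := sin2_cos2 y). assert (sqr := cosh_sqr x). unfold Rsqr in unit.
    assert (cos_sqr := pow2_ge_0 (cos y)). nra. }
  assert (Cmod_diff : Cmod (ell_map c k th (x, y) - c) = k * Cmod (ccosh (x, y))).
  { unfold ell_map.
    replace (c + (cos th, sin th) * RtoC k * ccosh (x, y) - c)%C
      with ((cos th, sin th) * RtoC k * ccosh (x, y))%C by ring.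
    rewrite !Cmod_mult, Cmod_rotation, Cmod_R, Rabs_pos_eq by lra. ring. }
  assert (triangle := Cmod_triangle (ell_map c k th (x, y)) (- c)).
  rewrite Cmod_opp in triangle. fold (ell_map c k th (x, y) - c)%C in triangle.
  assert (k * (x / 2) <= k * Cmod (ccosh (x, y))) by (apply Rmult_le_compat_l; lra).
  lra.
Qed.

(** * The matching problem *)

Lemma vanishes_at_infty (g : C -> C) :
  C_differentiable (chart_at_infty g) (RtoC 0) ->
  forall eps, 0 < eps -> exists M, forall z, M < Cmod z -> Cmod (g z) < eps.
Proof.
  intros chart_diff eps eps_pos.
  assert (chart_0 : chart_at_infty g (RtoC 0) = RtoC 0).
  { unfold chart_at_infty. rewrite Cmod_0. destruct Req_EM_T; [reflexivity | contradiction]. }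
  destruct (ex_derive_continuous _ _ chart_diff
    (fun v => Cmod (v - chart_at_infty g (RtoC 0)) < eps)) as [d near].
  { apply locally_C. exists (mkposreal eps eps_pos). intros v v_near. exact v_near. }
  assert (d_pos := cond_pos d).
  exists (/ d). intros z z_large.
  assert (inv_d_pos : 0 < / d) by (apply Rinv_0_lt_compat, d_pos).
  assert (z_ne : z <> RtoC 0) by (intros ->; rewrite Cmod_0 in z_large; lra).
  assert (chart_inv : chart_at_infty g (/ z)%C = g z).
  { unfold chart_at_infty. rewrite Cmod_inv by exact z_ne.
    destruct Req_EM_T as [inv0 | _]; [| f_equal; field; exact z_ne].
    assert (0 < / Cmod z) by (apply Rinv_0_lt_compat; lra). lra. }
  specialize (near (/ z)%C). rewrite chart_inv, chart_0 in near.
  replace (g z - 0)%C with (g z) in near by ring. apply near.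
  change (Cmod (/ z - 0) < d). replace (/ z - 0)%C with (/ z)%C by ring.
  rewrite Cmod_inv by exact z_ne. rewrite <- (Rinv_inv d).
  apply Rinv_lt_contravar; [apply Rmult_lt_0_compat; lra | exact z_large].
Qed.

Lemma folded_matching_zero_at_fold (x0 r : R) (F G : C -> C) :
  0 < x0 -> 0 < r ->
  periodic_holomorphic 0 x0 (- r) r F ->
  (forall X, x0 <= X -> periodic_holomorphic x0 X (- r) r G) ->
  right_decaying x0 G ->
  (forall y, F (0, - y) = F (0, y)) ->
  (forall y, F (x0, y) = Cconj (G (x0, y))) ->
  forall y, - r <= y <= r -> F (0, y) = RtoC 0.
Proof.
  intros x0_pos r_pos F_per G_per G_decay F_even FG.
  set (FF := fun u => (F u * Cconj (F (Cconj u)))%C).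
  set (GG := fun u => (G u * Cconj (G (Cconj u)))%C).
  assert (FF_per : periodic_holomorphic 0 x0 (- r) r FF)
    by (apply periodic_holomorphic_mult, periodic_holomorphic_conj_conj; exact F_per).
  assert (GG_per : forall X, x0 <= X -> periodic_holomorphic x0 X (- r) r GG).
  { intros X X_ge. apply periodic_holomorphic_mult, periodic_holomorphic_conj_conj;
      apply G_per, X_ge. }
  assert (GG_decay : right_decaying x0 GG).
  { intros eps eps_pos.
    destruct (G_decay (Rmin 1 eps)) as (X & X_ge & G_small); [apply Rmin_glb_lt; lra |].
    exists X. split; [exact X_ge |]. intros y.
    unfold GG. rewrite Cmod_mult, Cmod_conj, <- (Rmult_1_l eps).
    apply Rmult_le_compat; try apply Cmod_ge_0;
      (eapply Rle_trans; [apply G_small |]); [apply Rmin_l | apply Rmin_r]. }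
  apply (RInt_Cmod_sqr_zero 0 x0 (- r) r 0 F FF); [lra | lra | apply FF_per | |].
  - intros y. unfold FF, Cconj; simpl. rewrite F_even. reflexivity.
  - rewrite (RInt_Re_periodic_holomorphic 0 x0 (- r) r FF ltac:(lra) ltac:(lra) FF_per).
    rewrite <- (RInt_Re_halfstrip_zero x0 (- r) r GG ltac:(lra) GG_per GG_decay).
    apply RInt_ext. intros y _.
    change (Re (F (x0, y) * Cconj (F (x0, - y))) = Re (G (x0, y) * Cconj (G (x0, - y)))).
    rewrite !FG, <- Cmult_conj, re_conj. reflexivity.
Qed.

Lemma folded_matching_zero (x0 r : R) (F G : C -> C) :
  0 < x0 -> 0 < r ->
  periodic_holomorphic 0 x0 (- r) r F ->
  (forall X, x0 <= X -> periodic_holomorphic x0 X (- r) r G) ->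
  right_decaying x0 G ->
  (forall y, F (0, - y) = F (0, y)) ->
  (forall y, F (x0, y) = Cconj (G (x0, y))) ->
  (forall x y, 0 <= x <= x0 -> - r <= y <= r -> F (x, y) = RtoC 0) /\
  (forall x y, x0 <= x -> - r <= y <= r -> G (x, y) = RtoC 0).
Proof.
  intros x0_pos r_pos F_per G_per G_decay F_even FG.
  assert (F0 : forall x y, 0 <= x <= x0 -> - r <= y <= r -> F (x, y) = RtoC 0).
  { apply periodic_holomorphic_zero; [exact x0_pos | lra | exact F_per |].
    apply (folded_matching_zero_at_fold x0 r F G); assumption. }
  split; [exact F0 |]. intros x y x_ge y_in.
  apply (periodic_holomorphic_zero x0 (x + 1) (- r) r);
    [lra | lra | apply G_per; lra | | lra | lra].
  intros t t_in. rewrite <- (Cconj_conj (G (x0, t))), <- FG, F0 by lra.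
  unfold Cconj; simpl. rewrite Ropp_0. reflexivity.
Qed.

Lemma periodic_holomorphic_pullback (al be a b : R) (W f : C -> C) (S U : C -> Prop) :
  (forall u, C_differentiable W u) -> (forall x, W (x, a) = W (x, b)) ->
  continuous_on S f -> (forall u, closed_strip al be u -> S (W u)) ->
  holomorphic_on U f -> (forall u, open_strip al be u -> U (W u)) ->
  periodic_holomorphic al be a b (fun u => f (W u)).
Proof.
  intros W_diff W_per f_cont W_S f_hol W_U. split; [| split].
  - apply (continuous_on_comp _ S); [| exact f_cont | exact W_S].
    apply continuous_continuous_on. intros u. apply C_differentiable_continuous, W_diff.
  - intros u u_in. apply C_differentiable_comp; [apply f_hol, W_U, u_in | apply W_diff].
  - intros x _. rewrite W_per. reflexivity.
Qed.

Section EllipticPullback.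

Variables (c : C) (k x0 th : R) (f g : C -> C).
Hypotheses (k_pos : 0 < k) (x0_pos : 0 < x0).
Hypothesis fg_match : matching_solution c (k * cosh x0) (k * sinh x0) th f g.

Lemma interior_pullback_periodic_holomorphic :
  periodic_holomorphic 0 x0 (- PI) PI (fun u => f (ell_map c k th u)).
Proof.
  destruct fg_match as (f_hol & f_cont & _).
  eapply periodic_holomorphic_pullback; [| | exact f_cont | | exact f_hol |].
  - apply C_differentiable_ell_map.
  - apply ell_map_periodic.
  - intros [x y] [x_ge x_le]. simpl in x_ge, x_le.
    destruct (ell_q_ell_map_compare c k x0 th x y k_pos x0_pos x_ge) as [_ gt].
    apply Rnot_lt_le. rewrite gt. lra.
  - intros [x y] [x_gt x_lt]. simpl in x_gt, x_lt.
    apply ell_q_ell_map_compare; lra.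
Qed.

Lemma exterior_pullback_periodic_holomorphic (X : R) :
  periodic_holomorphic x0 X (- PI) PI (fun u => g (ell_map c k th u)).
Proof.
  destruct fg_match as (_ & _ & g_hol & _ & g_cont & _).
  eapply periodic_holomorphic_pullback; [| | exact g_cont | | exact g_hol |].
  - apply C_differentiable_ell_map.
  - apply ell_map_periodic.
  - intros [x y] [x_ge _]. simpl in x_ge.
    destruct (ell_q_ell_map_compare c k x0 th x y k_pos x0_pos ltac:(lra)) as [lt _].
    apply Rnot_lt_le. rewrite lt. lra.
  - intros [x y] [x_gt _]. simpl in x_gt.
    apply ell_q_ell_map_compare; lra.
Qed.

Lemma exterior_pullback_right_decaying : right_decaying x0 (fun u => g (ell_map c k th u)).
Proof.
  destruct fg_match as (_ & _ & _ & chart_diff & _).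
  intros eps eps_pos.
  destruct (vanishes_at_infty g chart_diff eps eps_pos) as [M g_small].
  set (X := Rmax x0 (2 * (M + Cmod c + 1) / k)).
  assert (X_ge : x0 <= X) by apply Rmax_l.
  assert (X_large : 2 * (M + Cmod c + 1) / k <= X) by apply Rmax_r.
  apply Rle_div_l in X_large; [| exact k_pos].
  exists X. split; [exact X_ge |]. intros y. apply Rlt_le, g_small.
  assert (Cmod_ge := Cmod_ell_map_ge c k th X y k_pos ltac:(lra)). lra.
Qed.

Lemma elliptic_matching_solution_zero :
  (forall z, ell_interior_closure c (k * cosh x0) (k * sinh x0) th z -> f z = RtoC 0) /\
  (forall z, ell_exterior_closure c (k * cosh x0) (k * sinh x0) th z -> g z = RtoC 0).
Proof.
  destruct (folded_matching_zero x0 PI (fun u => f (ell_map c k th u))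
    (fun u => g (ell_map c k th u)) x0_pos PI_RGT_0) as [F0 G0].
  - apply interior_pullback_periodic_holomorphic.
  - intros X _. apply exterior_pullback_periodic_holomorphic.
  - apply exterior_pullback_right_decaying.
  - intros y. rewrite ell_map_fold. reflexivity.
  - intros y. apply fg_match, ell_q_ell_map_curve; assumption.
  - split; intros z z_in;
      destruct (ell_map_onto c k th z k_pos) as (x & y & x_nonneg & y_in & <-);
      destruct (ell_q_ell_map_compare c k x0 th x y k_pos x0_pos x_nonneg) as [lt gt].
    + apply F0; [split; [exact x_nonneg |] | exact y_in].
      apply Rnot_lt_le. rewrite <- gt. apply Rle_not_lt, z_in.
    + apply G0; [| exact y_in].
      apply Rnot_lt_le. rewrite <- lt. apply Rle_not_lt, z_in.
Qed.

End EllipticPullback.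

Lemma matching_solution_zero (c : C) (a b th : R) (f g : C -> C) :
  0 < b -> b < a -> matching_solution c a b th f g ->
  (forall z, ell_interior_closure c a b th z -> f z = RtoC 0) /\
  (forall z, ell_exterior_closure c a b th z -> g z = RtoC 0).
Proof.
  intros b_pos b_a.
  destruct (focal_parameters a b b_pos b_a) as (k & x0 & k_pos & x0_pos & -> & ->).
  apply elliptic_matching_solution_zero; assumption.
Qed.

Lemma ell_q_swap (c : C) (a b th : R) : ell_q c b a (th + PI / 2) = ell_q c a b th.
Proof.
  apply functional_extensionality. intros z.
  unfold ell_q. rewrite cos_plus, sin_plus, cos_PI2, sin_PI2. simpl. unfold Rdiv. ring.
Qed.

Theorem theorem3p21 (c : C) (a b th : R) (f g : C -> C) :
  0 < b -> 0 < a -> a <> b ->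
  matching_solution c a b th f g ->
  (exists k : C, forall z, ell_interior_closure c a b th z -> f z = k) /\
  (exists k : C, forall z, ell_exterior_closure c a b th z -> g z = k).
Proof.
  intros b_pos a_pos a_ne_b fg.
  enough (zero : (forall z, ell_interior_closure c a b th z -> f z = RtoC 0) /\
                 (forall z, ell_exterior_closure c a b th z -> g z = RtoC 0))
    by (split; exists (RtoC 0); apply zero).
  destruct (Rdichotomy a b a_ne_b) as [a_lt_b | b_lt_a].
  - unfold matching_solution, ell_interior, ell_exterior, ellipse in fg.
    unfold ell_interior_closure, ell_exterior_closure in *.
    rewrite <- ell_q_swap in fg |- *.
    exact (matching_solution_zero c b a (th + PI / 2) f g a_pos a_lt_b fg).
  - exact (matching_solution_zero c a b th f g b_pos b_lt_a fg).
Qed.
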